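(* For every graph $G$ with pathwidth $\theta$, $$\chi_{\mathrm{st}}(G)\le 3\theta+1.$$
   Context: All graphs are simple, finite and undirected. A star colouring of $G$ is a proper vertex colouring (adjacent vertices receive distinct colours) such that no path on four vertices in $G$ (a subgraph, not necessarily induced) is coloured with only two colours. The star chromatic number $\chi_{\mathrm{st}}(G)$ is the minimum number of colours in a star colouring of $G$. A path decomposition of $G$ is a sequence $B_1,\dots,B_p$ of subsets of $V(G)$ (bags) such that the endpoints of each edge of $G$ appear together in some bag, and for each vertex $v$ the set $\{x : v\in B_x\}$ is a nonempty set of consecutive indices. Its width is $\max_x |B_x|-1$, and the pathwidth of $G$ is the minimum width of a path decomposition of $G$. *)

(* Defs.v *)
From mathcomp Require Import all_boot.
From mathcomp Require Import boolp.

Set Implicit Arguments.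
Unset Strict Implicit.
Unset Printing Implicit Defensive.

Record sgraph := SGraph {
  vertex :> finType;
  adj : rel vertex;
  adj_sym : symmetric adj;
  adj_irrefl : irreflexive adj }.

Definition proper_colouring (G : sgraph) (k : nat) (c : {ffun G -> 'I_k}) :=
  [forall x, forall y, adj x y ==> (c x != c y)].

(* A path on four vertices, as a not necessarily induced subgraph, is a
   duplicate-free 4-tuple whose consecutive entries are adjacent. *)
Definition is_P4 (G : sgraph) (p : 4.-tuple G) :=
  uniq p && sorted (@adj G) p.

Definition star_colouring (G : sgraph) (k : nat) (c : {ffun G -> 'I_k}) :=
  proper_colouring c &&
  [forall p : 4.-tuple G, is_P4 p ==> ~~ (#|[set c x | x in p]| <= 2)].

Definition star_colourable (G : sgraph) (k : nat) :=
  [exists c : {ffun G -> 'I_k}, star_colouring c].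

Lemma star_colourable_ex (G : sgraph) : exists k, star_colourable G k.
Proof.
exists #|G|; apply/existsP; exists [ffun x => enum_rank x].
have inj : injective [ffun x : G => enum_rank x].
  by move=> x y; rewrite !ffunE; apply: enum_rank_inj.
apply/andP; split.
  apply/forallP=> x; apply/forallP=> y; apply/implyP=> exy.
  by apply/eqP=> /inj eq_xy; rewrite eq_xy adj_irrefl in exy.
apply/forallP=> p; apply/implyP=> /andP[/card_uniqP cp _].
by rewrite (card_imset _ inj) cp size_tuple.
Qed.

Definition star_chromatic_number (G : sgraph) : nat :=
  ex_minn (star_colourable_ex G).

(* The bags are indexed from 0 to (size B).-1. *)
Definition path_decomposition (G : sgraph) (B : seq {set G}) : Prop :=
  [/\ forall x y : G, adj x y -> exists2 b, b \in B & (x \in b) && (y \in b),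
      forall v : G, exists2 b, b \in B & v \in b
    & forall (v : G) (i j k : nat), i <= j <= k -> k < size B ->
        v \in nth set0 B i -> v \in nth set0 B k -> v \in nth set0 B j].

(* The predecessor is truncated: this only matters for the graph with no
   vertices, whose pathwidth is 0 by this convention. *)
Definition width (G : sgraph) (B : seq {set G}) : nat :=
  (\max_(b <- B) #|b|).-1.

Definition has_path_decomposition_of_width (G : sgraph) (w : nat) : Prop :=
  exists2 B : seq {set G}, path_decomposition B & width B = w.

Lemma path_decomposition_width_ex (G : sgraph) :
  exists w, `[< has_path_decomposition_of_width G w >].
Proof.
exists (width [:: [set: G]]); apply/asboolP; exists [:: [set: G]] => //.
split=> [x y _ | v | v i j k /andP[_ le_jk]].
- by exists setT; rewrite ?inE.
- by exists setT; rewrite ?inE.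
- case: k le_jk => [|k] //; rewrite leqn0 => /eqP-> _ _.
  by rewrite /= inE.
Qed.

Definition pathwidth (G : sgraph) : nat :=
  ex_minn (path_decomposition_width_ex G).

(* Main.v *)
Require Import Defs.
From mathcomp Require Import all_boot.
From mathcomp Require Import boolp zify.

Set Implicit Arguments.
Unset Strict Implicit.
Unset Printing Implicit Defensive.

(** Induct on the width, spending three new colours to lower it by one.

    Read the bags from left to right, so that each vertex occupies an interval
    of positions. Build a track of vertices [v_0], [v_1], ... greedily: starting
    from position [t_0 = 0], let [v_i] be a vertex of the bag at [t_i] that
    survives as far to the right as possible, and let [t_(i+1)] be the position
    just after its interval; an empty bag contributes no vertex and the next
    position is tried. The track meets every nonempty bag, so deleting it
    lowers the width ([greedy_track]).

    If one vertex [y] shares bags with both [v_i] and [v_j], then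
    [j <= i + 2]: otherwise [y] would lie in the bags at both [t_(i+1)] and
    [t_(i+2)], and so it would survive longer than the greedy choice [v_(i+1)].
    Colouring [v_i] with [i] mod 3, no vertex shares bags with two distinct
    track vertices of the same colour ([track_colouring]).

    Use these three new colours on the track and, by induction, [3 * k + 1] old
    colours elsewhere. A four-vertex path in two colours alternates, [x], [y],
    [z], [w] with [x], [z] alike and [y], [w] alike. If [x] and [z] are on the
    track, then [y] sees two track vertices of the same colour; if [y] and [w]
    are, then [z] does. Otherwise the path avoids the track and the induction
    hypothesis applies ([star_colouring_of_bags]). *)

(** * Families of bags *)

Definition convex_bags (T : finType) (bag : nat -> {set T}) : Prop :=
  forall v i j k, i <= j <= k -> v \in bag i -> v \in bag k -> v \in bag j.

Definition meet (T : finType) (bag : nat -> {set T}) (u v : T) : Prop :=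
  exists2 x, u \in bag x & v \in bag x.

Lemma meet_sym (T : finType) (bag : nat -> {set T}) u v :
  meet bag u v -> meet bag v u.
Proof. by case=> x ux vx; exists x. Qed.

(** * The greedy track *)

(** One step from position [t]. The next position [s] is the first one after [t] whose
    bag shares nothing with the bag at [t]; a vertex common to the bags at [t] and
    [s.-1] is then one that survives longest, and by convexity it hits every bag
    in between. The option is [None] when the bag at [t] is empty. *)
Lemma greedy_step (T : finType) (bag : nat -> {set T}) (n : nat) :
    convex_bags bag -> (forall x, n <= x -> bag x = set0) -> forall t,
  exists sv : nat * option T,
    [/\ t < sv.1, [disjoint bag t & bag sv.1],
        forall v, sv.2 = Some v -> v \in bag t
      & forall x, t <= x < sv.1 -> bag x != set0 ->
          exists2 v, sv.2 = Some v & v \in bag x].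
Proof.
move=> cvx bag0 t.
have exs : exists s, (t < s) && [disjoint bag t & bag s].
  exists (maxn t.+1 n); rewrite leq_maxl /= (bag0 (maxn _ _)) ?leq_maxr //.
  by rewrite -setI_eq0 setI0.
case: (ex_minnP exs) => s /andP[lt_ts dis] min_s.
exists (s, [pick v in bag t :&: bag s.-1]).
split=> //= [v | x /andP[le_tx lt_xs]].
  by case: pickP => // u /setIP[ut _] [<-].
case: pickP => [v /setIP[vt vs] _ | none /negP[]].
  by exists v => //; apply: cvx vt vs; lia.
have dis' : [disjoint bag t & bag s.-1].
  by rewrite -setI_eq0; apply/eqP/setP=> v; rewrite in_set0; apply: none.
(* Minimality of [s] leaves only the case of an empty bag at [t = s.-1]. *)
have st : s.-1 = t.
  case: (ltnP t s.-1) => [lt_ts1|]; last by lia.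
  by have := min_s s.-1; rewrite lt_ts1 dis' => /(_ isT); lia.
have -> : x = t by lia.
by move: dis'; rewrite st -setI_eq0 setIid.
Qed.

Lemma strictly_increasing_geq (t : nat -> nat) :
  (forall i, t i < t i.+1) -> forall i j, i <= j -> t i <= t j.
Proof.
move=> inc i j /subnKC <-; elim: (j - i) => [|m IH]; first by rewrite addn0.
by rewrite addnS; apply: leq_trans IH (ltnW (inc _)).
Qed.

(** Every position [x] lies in exactly one of the segments cut by the greedy
    positions, which gives the first conclusion. The bound [i <= x] serves to
    index the track by a finite type. *)
Lemma greedy_track (T : finType) (bag : nat -> {set T}) (n : nat) :
    convex_bags bag -> (forall x, n <= x -> bag x = set0) ->
  exists track : nat -> option T,
    (forall x, bag x != set0 ->
       exists i v, [/\ i <= x, track i = Some v & v \in bag x]) /\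
    (forall y u v i j, track i = Some u -> track j = Some v ->
       meet bag y u -> meet bag y v -> j <= i.+2).
Proof.
move=> cvx bag0; have [step stepP] := choice (greedy_step cvx bag0).
pose t i := iter i (fun x => (step x).1) 0.
have inc i : t i < t i.+1 by case: (stepP (t i)).
have dis i v : v \in bag (t i) -> v \in bag (t i.+1) -> false.
  case: (stepP (t i)) => _ d _ _ vi vj.
  by rewrite (disjointFr d vi) in vj.
have start i v : (step (t i)).2 = Some v -> v \in bag (t i).
  by case: (stepP (t i)) => _ _ + _; apply.
exists (fun i => (step (t i)).2); split=> [x nz | y u v i j fu fv yu yv].
  have [i le_ix seg] : exists2 i, i <= x & t i <= x < t i.+1.
    elim: x {nz} => [|x [i le_ix /andP[le_tx lt_xt]]].
      by exists 0 => //=; apply: (inc 0).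
    case: (ltnP x.+1 (t i.+1)) => le_x1.
      by exists i; lia.
    by exists i.+1; have := inc i.+1; lia.
  by case: (stepP (t i)) => _ _ _ /(_ x seg nz) [v fv vx]; exists i, v.
case: (leqP j i.+2) => // lt_ij.
case: yu yv => p yp up [q yq vq].
(* To meet [u], the vertex [y] must reach left of [t i.+1]; to meet [v], right of
   [t j.-1]. When [j > i.+2], it spans both [t i.+1] and [t i.+2]. *)
have lt_p : p < t i.+1.
  case: (ltnP p (t i.+1)) => // le_tp.
  suff: false by [].
  by apply: (dis i u (start _ _ fu)); apply: cvx (start _ _ fu) up; rewrite ltnW.
have jE : j = j.-1.+1 by lia.
have lt_q : t j.-1 < q.
  case: (ltnP (t j.-1) q) => // le_qt.
  suff: false by [].
  have vj := start _ _ fv; rewrite jE in vj.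
  apply: (dis j.-1 v _ vj).
  by apply: cvx vq vj; rewrite le_qt ltnW.
have le_t : t i.+2 <= t j.-1 by apply: strictly_increasing_geq => //; lia.
have lt_t := inc i.+1.
by apply: (dis i.+1 y); apply: cvx yp yq; lia.
Qed.

Lemma track_colouring (T : finType) (bag : nat -> {set T}) (n : nat) :
    convex_bags bag -> (forall x, n <= x -> bag x = set0) ->
  exists (P : {set T}) (col : T -> nat),
    [/\ forall v, col v < 3,
        forall x, bag x != set0 -> exists2 v, v \in P & v \in bag x
      & forall y u v, u \in P -> v \in P -> meet bag y u -> meet bag y v ->
          col u = col v -> u = v].
Proof.
move=> cvx bag0; have [track [hit near]] := greedy_track cvx bag0.
pose idx v := [pick i : 'I_n | track i == Some v].
exists [set v | idx v].
exists (fun v => if idx v is Some i then i %% 3 else 0); split.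
- by move=> v; case: (idx v) => // i; rewrite ltn_mod.
- move=> x nz; have [i [v [le_ix fv vx]]] := hit x nz; exists v => //.
  have lt_xn : x < n by rewrite ltnNge; apply: contraNN nz => /bag0->.
  rewrite inE /idx; case: pickP => // /(_ (Ordinal (leq_ltn_trans le_ix lt_xn))).
  by rewrite /= fv eqxx.
- move=> y u v; rewrite !inE /idx.
  case: pickP => // i /eqP fu _; case: pickP => // j /eqP fv _ yu yv eq_ij.
  have := near _ _ _ _ _ fu fv yu yv; have := near _ _ _ _ _ fv fu yv yu.
  move=> le_ij le_ji; have eqij : (i : nat) = j by lia.
  by move: fu; rewrite eqij fv => -[].
Qed.

(** * Colouring the bags *)

(** Treating any two vertices that share a bag as adjacent, instead of following
    a given graph, makes the induction depend on the bags alone: deleting the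
    track from every bag gives another family of the same kind. *)
Lemma star_colouring_of_bags (T : finType) (n k : nat) (bag : nat -> {set T}) :
    convex_bags bag -> (forall x, n <= x -> bag x = set0) ->
    (forall x, #|bag x| <= k.+1) ->
  exists c : T -> nat,
    [/\ forall v, c v < 3 * k + 1,
        forall u v, meet bag u v -> c u = c v -> u = v
      & forall x y z w, meet bag x y -> meet bag y z -> meet bag z w ->
          c x = c z -> c y = c w -> x = z \/ y = w].
Proof.
elim: k bag => [|k IH] bag cvx bag0 small.
  have meet_eq u v : meet bag u v -> u = v.
    by case=> x ux vx; apply: (card_le1_eqP (small x)).
  exists (fun=> 0); split=> // [u v /meet_eq // | x y z w].
  by move=> /meet_eq-> /meet_eq->; left.
have [P [col [col3 hit inj]]] := track_colouring cvx bag0.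
pose bag' x := bag x :\: P.
have [|||c [cmax cprop cstar]] := IH bag'.
- by move=> v i j l ijl /setDP[vi vP] /setDP[vl _]; rewrite inE vP (cvx v i j l).
- by move=> x /bag0; rewrite /bag' => ->; rewrite set0D.
- move=> x; rewrite /bag'; have [->|/hit[v vP vx]] := eqVneq (bag x) set0.
    by rewrite set0D cards0.
  rewrite -ltnS; apply: leq_trans (small x); apply: proper_card.
  rewrite properE subsetDl; apply/subsetPn; exists v => //.
  by rewrite inE vP.
pose c' v := if v \in P then 3 * k + 1 + col v else c v.
have cP u v : c' u = c' v -> (u \in P) = (v \in P).
  rewrite /c'; have := cmax u; have := cmax v.
  by case: (u \in P); case: (v \in P) => //; lia.
have cinj y u v : meet bag y u -> meet bag y v -> u \in P -> c' u = c' v -> u = v.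
  move=> yu yv uP eq_c; have vP : v \in P by rewrite -(cP _ _ eq_c).
  by apply: (inj y) => //; move: eq_c; rewrite /c' uP vP; lia.
have off u v : u \notin P -> v \notin P -> meet bag u v -> meet bag' u v.
  by move=> uP vP [x ux vx]; exists x; rewrite inE ?uP ?vP.
exists c'; split.
- move=> v; rewrite /c'; have := cmax v; have := col3 v.
  by case: ifP => _; lia.
- move=> u v uv eq_c; case: (boolP (u \in P)) => uP.
    by apply: (cinj u) => //; case: uv => x ux _; exists x.
  have vP : v \notin P by rewrite -(cP _ _ eq_c).
  apply: cprop (off _ _ uP vP uv) _.
  by move: eq_c; rewrite /c' (negbTE uP) (negbTE vP).
- move=> x y z w xy yz zw eq_xz eq_yw.
  case: (boolP (x \in P)) => xP.
    by left; apply: (cinj y) => //; apply: meet_sym.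
  case: (boolP (y \in P)) => yP.
    by right; apply: (cinj z) => //; apply: meet_sym.
  have zP : z \notin P by rewrite -(cP _ _ eq_xz).
  have wP : w \notin P by rewrite -(cP _ _ eq_yw).
  move: eq_xz eq_yw; rewrite /c' !ifN //.
  by apply: cstar; apply: off.
Qed.

(** * Star colourings of graphs *)

(** In a proper colouring a two-coloured path on four vertices alternates, so
    it suffices to rule out alternating paths. *)
Lemma star_colouringP (G : sgraph) (k : nat) (c : {ffun G -> 'I_k}) :
    (forall x y, adj x y -> c x != c y) ->
    (forall x y z w, adj x y -> adj y z -> adj z w ->
       c x = c z -> c y = c w -> x = z \/ y = w) ->
  star_colouring c.
Proof.
move=> proper star; apply/andP; split.
  by apply/forallP=> x; apply/forallP=> y; apply/implyP; apply: proper.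
apply/forallP=> p; apply/implyP; rewrite /is_P4.
case/tupleP: p => x p; case/tupleP: p => y p; case/tupleP: p => z p.
case/tupleP: p => w p; rewrite (tuple0 p) => /andP[uniq_p].
rewrite /= andbT => /and3P[xy yz zw].
apply/negP=> le2.
set C := (X in #|pred_of_set X|) in le2.
have few a b d : [/\ a \in C, b \in C & d \in C] ->
    a != b -> b != d -> a = d.
  case=> aC bC dC ab bd; apply/eqP; apply: contraTT le2 => ad.
  have /card_uniqP card3 : uniq [:: a; b; d] by rewrite /= !inE negb_or ab ad bd.
  rewrite -ltnNge -[3]card3; apply: subset_leq_card; apply/subsetP=> e.
  by rewrite !inE => /or3P[] /eqP->.
have [xC yC zC wC] : [/\ c x \in C, c y \in C, c z \in C & c w \in C].
  by split; apply: imset_f; rewrite !inE eqxx ?orbT.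
have eq_xz : c x = c z by apply: (few _ (c y)) => //; apply: proper.
have eq_yw : c y = c w by apply: (few _ (c z)) => //; apply: proper.
move: uniq_p; rewrite /= !inE !negb_or.
by case: (star x y z w xy yz zw eq_xz eq_yw) => ->; rewrite eqxx ?andbF.
Qed.

Lemma star_colourable_of_path_decomposition (G : sgraph) (B : seq {set G}) :
  path_decomposition B -> star_colourable G (3 * width B + 1).
Proof.
move=> [edgeB _ cvxB]; pose bag := nth set0 B.
have bag0 x : size B <= x -> bag x = set0 by move=> ?; rewrite /bag nth_default.
have cvx : convex_bags bag.
  move=> v i j k ijk vi vk; apply: (cvxB v i j k) => //.
  by rewrite ltnNge; apply: contraL vk => /bag0->; rewrite inE.
have small x : #|bag x| <= (width B).+1.
  case: (ltnP x (size B)) => [lt_x | /bag0->]; last by rewrite cards0.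
  apply: leq_trans (leqSpred _).
  by apply: (leq_bigmax_seq (F := fun b : {set G} => #|b|)); rewrite ?mem_nth.
have [c [cmax cprop cstar]] := star_colouring_of_bags cvx bag0 small.
have adj_meet x y : adj x y -> meet bag x y.
  move=> /edgeB[b bB /andP[xb yb]].
  by exists (index b B); rewrite /bag nth_index.
apply/existsP; exists [ffun v => Ordinal (cmax v)].
apply: star_colouringP => [x y xy | x y z w xy yz zw].
  apply/eqP; rewrite !ffunE => -[/(cprop _ _ (adj_meet _ _ xy)) eq_xy].
  by rewrite eq_xy adj_irrefl in xy.
rewrite !ffunE => -[eq_xz] [eq_yw].
by apply: cstar eq_xz eq_yw; apply: adj_meet.
Qed.

Theorem theorem4 (G : sgraph) (theta : nat) (pwG : pathwidth G = theta) :
  star_chromatic_number G <= 3 * theta + 1.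
Proof.
move: pwG; rewrite /pathwidth; case: ex_minnP => w /asboolP[B decB <-] _ <-.
rewrite /star_chromatic_number; case: ex_minnP => m _; apply.
exact: star_colourable_of_path_decomposition.
Qed.
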